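(* Let $\mu$ be a singular cardinal with $\mu>\operatorname{cf}(\mu)=\omega$, assume $2^\mu=\mu^+$, and let $\kappa$ be a cardinal such that $\kappa\rightarrow_{\rm ipath}(\omega)^2_\omega$, or even only $\kappa\rightarrow_{\rm ipath}(\omega)^2_{\omega,<\omega}$. Then there is a coloring $c:\mu^+\times\mu^+\rightarrow 2$ such that: (i) there are no $A,B\subseteq\mu^+$ with $\operatorname{otp}(A)=\mu^+$, $\operatorname{otp}(B)=\mu$ and $c''(A\times B)=\{0\}$; (ii) there are no $A,B\subseteq\mu^+$ with $c''(A\times B)=\{1\}$ and either ($\operatorname{otp}(A)=\kappa$ and $\operatorname{otp}(B)=\mu$) or ($\operatorname{otp}(A)=1$ and $\operatorname{otp}(B)=\mu^+$). In arrow notation: $\binom{\mu^+}{\mu^+}\nrightarrow\left(\begin{matrix}\mu^+\\ \mu\end{matrix}\ \ \begin{matrix}\kappa\\ \mu\end{matrix}\vee\begin{matrix}1\\ \mu^+\end{matrix}\right)$.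
   Context: For cardinals $\theta\le\kappa$: $\kappa\rightarrow_{\rm ipath}(\omega)^2_\theta$ means that for every $c:[\kappa]^2\rightarrow\theta$ there exist a strictly increasing sequence $(\beta_n:n\in\omega)$ of ordinals below $\kappa$ and a color $\gamma\in\theta$ with $c(\{\beta_n,\beta_{n+1}\})=\gamma$ for all $n$. $\kappa\rightarrow_{\rm ipath}(\omega)^2_{\theta,<\omega}$ means that for every $c:[\kappa]^2\rightarrow\theta$ there is a strictly increasing sequence $(\beta_n:n\in\omega)$ of ordinals below $\kappa$ with $\{c(\{\beta_n,\beta_{n+1}\}):n\in\omega\}$ finite. $c''(A\times B)$ denotes the set of values of $c$ on $A\times B$, and $\operatorname{otp}$ denotes order type. *)

(* Defs.v *)
From mathcomp Require Import all_boot all_order.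
From mathcomp Require Import boolp classical_sets functions cardinality wochoice.

Set Implicit Arguments.
Unset Strict Implicit.
Unset Printing Implicit Defensive.

Import Order.TTheory.

Local Open Scope classical_set_scope.
Local Open Scope card_scope.
Local Open Scope order_scope.

Definition card_lt T U (A : set T) (B : set U) : Prop :=
  (A #<= B) /\ ~ (B #<= A).
Notation "A '#<' B" := (card_lt A B)
  (at level 79, format "A  '#<'  B") : card_scope.

(* Ordinals are represented by well-ordered types, and cardinals by initial
   ordinals: an initial ordinal does not inject into any of its proper initial
   segments. Cardinals include the finite ones. *)
Definition is_ordinal d (T : orderType d) : Prop := well_order (<=%O : rel T).

Definition is_cardinal d (T : orderType d) : Prop :=
  is_ordinal T /\ forall x : T, [set y | y < x] #< [set: T].

Definition otp_is d d' (X : orderType d) (A : set X) (T : orderType d') : Prop :=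
  exists f : T -> X, {mono f : x y / x <= y} /\ range f = A.

Definition is_succ_cardinal d d' (T : orderType d) (S : orderType d') : Prop :=
  [/\ is_cardinal S,
      [set: T] #< [set: S] &
      forall d'' (Q : orderType d''),
        is_cardinal Q -> [set: T] #< [set: Q] -> [set: S] #<= [set: Q]].

Definition cofinal d (T : orderType d) (A : set T) : Prop :=
  forall x : T, exists2 a, A a & x <= a.

Definition cofinality_is d d' (T : orderType d) (C : orderType d') : Prop :=
  [/\ is_cardinal C,
      exists A : set T, cofinal A /\ A #= [set: C] &
      forall A : set T, cofinal A -> [set: C] #<= A].

Definition is_singular d (T : orderType d) : Prop :=
  [/\ is_cardinal T,
      infinite_set [set: T] &
      exists d' (C : orderType d'), cofinality_is T C /\ [set: C] #< [set: T]].

Definition two_subsets (T : Type) : Type :=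
  {p : set T | exists x y, x <> y /\ p = [set x; y]}.

Lemma pair_subproof d (T : orderType d) (x y : T) :
  x < y -> exists x' y', x' <> y' /\ [set x; y] = [set x'; y'].
Proof. by move=> xy; exists x, y; split => // e; rewrite e ltxx in xy. Qed.

Definition two_subset d (T : orderType d) (x y : T) (xy : x < y) :
  two_subsets T := exist _ [set x; y] (pair_subproof xy).

(* Restricting attention to colour types that are at most as large as [K], as is
   usual for this arrow relation, is left to the user. *)
Definition ipath d (K : orderType d) (Theta : Type) : Prop :=
  forall c : two_subsets K -> Theta,
    exists (beta : nat -> K) (incr : forall n, beta n < beta n.+1)
           (gamma : Theta),
      forall n, c (two_subset (incr n)) = gamma.

Definition ipath_fin d (K : orderType d) (Theta : Type) : Prop :=
  forall c : two_subsets K -> Theta,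
    exists (beta : nat -> K) (incr : forall n, beta n < beta n.+1),
      finite_set (range (fun n => c (two_subset (incr n)))).

(* Main.v *)
From HB Require Import structures.
Require Import Defs.
From mathcomp Require Import all_boot all_order.
From mathcomp Require Import boolp classical_sets functions cardinality wochoice.

(* Since mu has cofinality omega, there is a rank rk(b, a) in omega for b < a < mu^+
   such that each {b < a | rk(b, a) <= n} has fewer than mu elements. Since
   2^mu = mu^+, the maps mu -> mu^+ are enumerated as (e_x : x < mu^+). Let
   c(a, z) = 1 iff z belongs to the union S(a) of the levels
   S(a, n) = {p(a, n, x) | x < a, rk(x, a) <= n, e_x injective}, where p(a, n, x) is
   chosen, by recursion on a, in the range of e_x but outside every S(b, l) with
   b < a, rk(b, a) <= n and l <= n; these sets have fewer than mu elements in all.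
   Every set of size mu is the range of some e_x, hence meets S(a) for all a > x,
   which gives (i), and S(a) has size at most mu. If A has order type kappa, the
   path relation applied to rk on A yields b_0 < b_1 < ... in A and n with
   rk(b_k, b_(k+1)) <= n for all k. If z lies in all the S(b_k) but in no S(b_k, l)
   with l <= n, then the levels at which z enters S(b_0), S(b_1), ... strictly
   decrease, which is absurd. So fewer than mu many z lie in all the S(b_k). *)

Set Implicit Arguments.
Unset Strict Implicit.
Unset Printing Implicit Defensive.

Import Order.TTheory.

Local Open Scope classical_set_scope.
Local Open Scope card_scope.
Local Open Scope order_scope.

(** * Cardinal arithmetic: comparability, products, squares of infinite sets *)

Lemma card_le_inj T U (A : set T) (B : set U) (f : T -> U) :
  (forall x, A x -> B (f x)) ->
  (forall x y, A x -> A y -> f x = f y -> x = y) -> A #<= B.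
Proof.
move=> fAB finj.
apply: (@card_le_trans _ _ _ (f @` A)); last first.
  by apply: subset_card_le => _ [x Ax <-]; exact: fAB.
have : f @` A #= A.
  by apply: inj_card_eq => x y /set_mem Ax /set_mem Ay; exact: finj.
by rewrite card_eq_le => /andP[].
Qed.

Lemma card_le_rel T U (A : set T) (B : set U) (R : T -> U -> Prop) :
  (forall x, A x -> exists2 y, B y & R x y) ->
  (forall x x' y, A x -> A x' -> R x y -> R x' y -> x = x') -> A #<= B.
Proof.
move=> RAB Rinj; have [->|/eqP/eqP/set0P[x0 Ax0]] := eqVneq A set0.
  exact: card_ge0.
have [y0 _ _] := RAB _ Ax0.
have /choice[f fP] : forall x, exists y, A x -> B y /\ R x y.
  move=> x; have [Ax|nAx] := pselect (A x); last by exists y0.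
  by have [y By Rxy] := RAB _ Ax; exists y.
apply: (card_le_inj (f := f)) => [x /fP[]//|x x' Ax Ax' e].
by apply: (Rinj _ _ (f x)) => //; [case: (fP _ Ax)|rewrite e; case: (fP _ Ax')].
Qed.

(** [y0] is the default value of the function outside [A]. *)
Lemma card_le_ex_inj T U (A : set T) (B : set U) : U -> A #<= B ->
  exists f : T -> U, (forall x, A x -> B (f x)) /\
    (forall x y, A x -> A y -> f x = f y -> x = y).
Proof.
move=> y0 /card_leP[f].
pose g x := if pselect (A x) is left Ax then val (f (SigSub (mem_set Ax))) else y0.
exists g; split=> [x Ax|x y Ax Ay]; rewrite /g.
  by case: pselect => // ?; exact: set_valP.
case: pselect => // Ax'; case: pselect => // Ay' /val_inj.
by move/(inj (f:=f)) => /(_ (mem_setT _) (mem_setT _)) [].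
Qed.

(** The conditions on graphs in the uses of Zorn's lemma below concern at most two members at a
    time, so they pass to unions of chains. *)
Lemma bigcup_chain2 T (F : set (set T)) x y : total_on F subset ->
  (\bigcup_(G in F) G) x -> (\bigcup_(G in F) G) y ->
  exists G, [/\ F G, G x & G y].
Proof.
move=> Ftot [G FG Gx] [H FH Hy].
by have [/(_ _ Gx) Hx|/(_ _ Hy) Gy] := Ftot _ _ FG FH; [exists H|exists G].
Qed.

(** A maximal partial bijection is total on one side: if it missed some [x] in [A] and some [y] in
    [B], the pair [(x, y)] could be added. *)
Lemma card_le_total T U (A : set T) (B : set U) : A #<= B \/ B #<= A.
Proof.
pose P (G : set (T * U)) := (forall p, G p -> A p.1 /\ B p.2) /\
  (forall p q, G p -> G q -> (p.1 = q.1 <-> p.2 = q.2)).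
have [F FP Ftot|G [[GAB Gbij] Gmax]] := @Zorn_bigcup _ P.
  split=> [p [G FG Gp]|p q Fp Fq]; first by have [+ _] := FP _ FG; exact.
  have [G [/FP[_ +] Gp Gq]] := bigcup_chain2 Ftot Fp Fq.
  exact.
have [AG|/existsNP[x /not_implyP[Ax nGx]]] :=
    pselect (forall x, A x -> exists y, G (x, y)).
  left; apply: (card_le_rel (R := fun x y => G (x, y))) => [x /AG[y Gxy]|].
    by exists y => //; have [] := GAB _ Gxy.
  by move=> x x' y _ _ Gx Gx'; apply/(Gbij _ _ Gx Gx').
right; apply: (card_le_rel (R := fun y x => G (x, y))) => [y By|].
  apply: contrapT => nGy.
  have {}nGy x' : ~ G (x', y).
    by move=> Gx'; apply: nGy; exists x' => //; have [] := GAB _ Gx'.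
  have {}nGx y' : ~ G (x, y') by move=> Gxy; apply: nGx; exists y'.
  apply: (Gmax (G `|` [set (x, y)])).
    rewrite properEneq; split; last exact: subsetUl.
    apply/eqP => /seteqP[_ /(_ (x, y))] GG.
    by apply: (nGx y); apply: GG; right.
  split=> [p [/GAB//|->//]|[a b] [a' b']] /=.
  move=> [Gp|[-> ->]] [Gq|[-> ->]] //=; first exact: (Gbij _ _ Gp Gq).
    by split=> e; subst; [have := nGx _ Gp|have := nGy _ Gp].
  by split=> e; subst; [have := nGx _ Gq|have := nGy _ Gq].
by move=> y y' z _ _ Gy Gy'; apply/(Gbij _ _ Gy Gy').
Qed.

Lemma card_leX T T' U U' (A : set T) (B : set U) (A' : set T') (B' : set U') :
  A #<= A' -> B #<= B' -> A `*` B #<= A' `*` B'.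
Proof.
have [->|/eqP/eqP/set0P[x0 Ax0]] := eqVneq A set0.
  by rewrite set0X => _ _; exact: card_ge0.
have [->|/eqP/eqP/set0P[y0 By0]] := eqVneq B set0.
  by rewrite setX0 => _ _; exact: card_ge0.
move=> AA' BB'.
have [x0' _] : A' !=set0.
  by apply/set0P/eqP => A'0; move: AA';
     rewrite A'0 card_le0 => /eqP A0; rewrite A0 in Ax0.
have [y0' _] : B' !=set0.
  by apply/set0P/eqP => A'0; move: BB';
     rewrite A'0 card_le0 => /eqP A0; rewrite A0 in By0.
have [f [fA finj]] := card_le_ex_inj x0' AA'.
have [g [gB ginj]] := card_le_ex_inj y0' BB'.
apply: (card_le_inj (f := fun p => (f p.1, g p.2))) => [p [/fA ? /gB ?]//|].
by move=> [x y] [x' y'] /= [Ax By] [Ax' By'] [/finj-> // /ginj->].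
Qed.

(** The second coordinates [c] and [c'] keep the images of [A] and of the rest of [B] apart. *)
Lemma card_leU T U (A B : set T) (C : set U) (c c' : U) : C c -> C c' ->
  c <> c' -> A #<= C -> B #<= C -> A `|` B #<= C `*` C.
Proof.
move=> Cc Cc' cc' AC BC.
have [f [fA finj]] := card_le_ex_inj c AC.
have [g [gB ginj]] := card_le_ex_inj c BC.
apply: (card_le_inj (f := fun x => if pselect (A x) then (f x, c) else (g x, c'))).
  move=> x; case: pselect => [/fA ? _//|nA [//|/gB ?]]; by [].
move=> x y; case: pselect => Ax; case: pselect => Ay //= ABx ABy [] //.
- exact: finj.
- by move=> _ /esym.
- by case: ABx ABy => // Bx [//|By]; exact: ginj.
Qed.

(* Zorn's lemma is applied to the injections [D `*` D -> D] with [D `<=` A],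
   represented by their graphs. If the complement of [D] were larger than [D], it
   would contain a copy [E] of [D] into which the rest of the square of
   [D `|` E] could be mapped. *)
Lemma card_le_square T (A : set T) : infinite_set A -> A `*` A #<= A.
Proof.
move=> Ainf.
pose fld (G : set (T * T * T)) : set T := [set x | exists z, G (x, x, z)].
pose P G := [/\ forall g, G g -> [/\ fld G g.1.1, fld G g.1.2 & fld G g.2],
  forall x y, fld G x -> fld G y -> exists z, G (x, y, z),
  forall g h, G g -> G h -> g.2 = h.2 -> g.1 = h.1 & fld G `<=` A].
have [F FP Ftot|G [[Gfld Gtot Ginj GA] Gmax]] := @Zorn_bigcup _ P.
  have Ffld G x : F G -> fld G x -> fld (\bigcup_(X in F) X) x.
    by move=> FG [z Gz]; exists z; exists G.
  split.
  - move=> g [G FG Gg]; have [+ _ _ _] := FP _ FG => /(_ _ Gg)[? ? ?].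
    by split; apply: (Ffld G).
  - move=> x y [u Fu] [v Fv].
    have [G [FG Gx Gy]] := bigcup_chain2 Ftot Fu Fv.
    have [_ + _ _] := FP _ FG => /(_ x y).
    by case; [exists u|exists v|move=> z Gz; exists z, G].
  - move=> g h Fg Fh; have [G [/FP[_ _ + _] Gg Gh]] := bigcup_chain2 Ftot Fg Fh.
    exact.
  - by move=> x [z [G /FP[_ _ _ GA] Gx]]; apply: GA; exists z.
set D := fld G in Gfld Gtot GA.
have DD : D `*` D #<= D.
  apply: (card_le_rel (R := fun p z => G (p, z))) => [[x y] [/= Dx Dy]|].
    by have [z Gz] := Gtot _ _ Dx Dy; exists z => //; have [] := Gfld _ Gz.
  by move=> p q z _ _ Gp Gq; apply: (Ginj _ _ Gp Gq).
have noE E : E `<=` A `\` D -> E !=set0 -> ~ ((D `|` E) `*` (D `|` E) #<= E).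
  move=> EA [e Ee] /(card_le_ex_inj e)[j [jE jinj]].
  have jD p : ((D `|` E) `*` (D `|` E)) p -> ~ D (j p).
    by move=> /jE/EA[].
  pose G' := G `|` [set g | [/\ (D `|` E) g.1.1, (D `|` E) g.1.2,
                      ~ (D g.1.1 /\ D g.1.2) & g.2 = j g.1]].
  have fldG' : fld G' = D `|` E.
    apply/seteqP; split=> x.
      by case=> z [Gz|[]//]; left; exists z.
    have [Dx _|Dx [//|Ex]] := pselect (D x).
      by have [z] := Dx; exists z; left.
    by exists (j (x, x)); right; split; [right|right|case|].
  apply: (Gmax G').
    rewrite properEneq; split; last exact: subsetUl.
    apply/eqP => GG'; have : fld G' e by rewrite fldG'; right.
    by rewrite -GG'; have [] := EA _ Ee.
  split; rewrite ?fldG'.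
  - move=> g [/Gfld[? ? ?]|[? ? _ ->]]; first by split; left.
    by split => //; right; apply: jE; split.
  - move=> x y DEx DEy; have [[Dx Dy]|nD] := pselect (D x /\ D y).
      by have [z Gz] := Gtot _ _ Dx Dy; exists z; left.
    by exists (j (x, y)); right.
  - move=> g h [Gg|[g1 g2 _ gj]] [Gh|[h1 h2 _ hj]] gh.
    + exact: Ginj gh.
    + by have [_ _] := Gfld _ Gg; rewrite gh hj => /jD; case; split.
    + by have [_ _] := Gfld _ Gh; rewrite -gh gj => /jD; case; split.
    + by apply: jinj; rewrite -?gj -?hj//; split.
  - by move=> x [/GA//|/EA[]].
have setX_nat : [set: nat] `*` [set: nat] #<= [set: nat].
  by rewrite setXTT; have := card_nat2; rewrite card_eq_le => /andP[].
have [[E [EA [e Ee [e' Ee' ee']] DE EE]]|[Dinf ADD]] :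
  (exists E, [/\ E `<=` A `\` D,
    exists2 e, E e & exists2 e', E e' & e <> e', D #<= E & E `*` E #<= E]) \/
    (infinite_set D /\ A `\` D #<= D).
- have [Dfin|Dinf] := pselect (finite_set D).
    (* For finite [D] the rest of [A] is infinite, and a copy of the naturals serves as [E]. *)
    left; have /infiniteP : infinite_set (A `\` D) by exact: infinite_setD.
    have [x0 _] := infinite_setN0 Ainf.
    case/(card_le_ex_inj x0) => f [fAD finj].
    have fle : [set: nat] #<= range f.
      by apply: (card_le_inj (f := f)) => [n _|m n _ _]; [exists n|exact: finj].
    have fge : range f #<= [set: nat] by exact: card_image_le.
    exists (range f); split.
    + by move=> _ [n _ <-]; exact: fAD.
    + by exists (f 0%N); [exists 0%N|exists (f 1%N)
         ; [exists 1%N|move/finj => /(_ I I)]].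
    + by apply: card_le_trans fle; exact: finite_set_countable.
    + exact: card_le_trans (card_leX fge fge) (card_le_trans setX_nat fle).
  have [DAD|] := card_le_total D (A `\` D); last by right.
  left; have [x0 _] := infinite_setN0 Ainf.
  have [f [fAD finj]] := card_le_ex_inj x0 DAD.
  have fle : D #<= f @` D.
    by apply: (card_le_inj (f := f)) => [x Dx|//]; exists x.
  have fge : f @` D #<= D by exact: card_image_le.
  exists (f @` D); split => //.
  + by move=> _ [x /fAD ? <-].
  + have /infiniteP/(card_le_ex_inj x0)[g [gD ginj]] := Dinf.
    exists (f (g 0%N)); first by exists (g 0%N) => //; exact: gD.
    exists (f (g 1%N)); first by exists (g 1%N) => //; exact: gD.
    by move/finj => /(_ (gD _ I) (gD _ I))/ginj => /(_ I I).
  + exact: card_le_trans (card_leX fge fge) (card_le_trans DD fle).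
- exfalso; apply: (noE E EA); first by exists e.
  have DUE := card_le_trans (card_leU Ee Ee' ee' DE (card_lexx E)) EE.
  exact: card_le_trans (card_leX DUE DUE) EE.
- have [x0 _] := infinite_setN0 Ainf.
  have /infiniteP/(card_le_ex_inj x0)[g [gD ginj]] := Dinf.
  have AleD : A #<= D.
    apply: (card_le_trans (subset_card_le (_ : A `<=` D `|` A `\` D))).
      by move=> x Ax; have [?|?] := pselect (D x); [left|right].
    apply: card_le_trans DD; apply: (card_leU (gD 0%N I) (gD 1%N I)) => //.
    by move=> /ginj => /(_ I I).
  apply: card_le_trans (card_leX AleD AleD) (card_le_trans DD _).
  exact: subset_card_le.
Qed.

Lemma card_ltNge T U (A : set T) (B : set U) : ~ (B #<= A) -> A #< B.
Proof. by move=> nBA; split=> //; have [//|/nBA] := card_le_total A B. Qed.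

Lemma card_le_lt_trans T U V (A : set T) (B : set U) (C : set V) :
  A #<= B -> B #< C -> A #< C.
Proof.
move=> AB [BC nCB]; apply: card_ltNge => CA; apply: nCB.
exact: card_le_trans CA AB.
Qed.

Lemma card_ltX T U V (A : set T) (B : set U) (C : set V) :
  [set: nat] #< C -> A #< C -> B #< C -> A `*` B #< C.
Proof.
move=> natC AC BC.
have square W (X : set W) : X #< C -> X `*` X #< C.
  move=> XC; have [Xfin|Xinf] := pselect (finite_set X).
    apply: card_le_lt_trans natC; apply: finite_set_countable.
    exact: finite_setX.
  exact: card_le_lt_trans (card_le_square Xinf) XC.
have [AB|BA] := card_le_total A B.
  exact: card_le_lt_trans (card_leX AB (card_lexx B)) (square _ _ BC).
exact: card_le_lt_trans (card_leX (card_lexx A) BA) (square _ _ AC).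
Qed.

(** * Well-orders, initial segments and successor cardinals *)

Lemma ordinal_min d (T : orderType d) (P : T -> Prop) x0 : is_ordinal T -> P x0 ->
  exists2 x, P x & forall y, y < x -> ~ P y.
Proof.
move=> Tord Px0; have [|x [[/asboolP Px xmin] _]] := Tord [pred x | `[< P x >]].
  by exists x0; apply/asboolP.
exists x => // y yx Py; have := xmin y (asboolT Py).
by rewrite leNgt yx.
Qed.

Lemma ordinal_wf d (T : orderType d) :
  is_ordinal T -> well_founded (fun x y : T => x < y).
Proof.
move=> Tord x; apply: contrapT => nAx.
have [y nAy ymin] := ordinal_min (P := fun x => ~ Acc _ x) Tord nAx.
by apply: nAy; constructor => z /ymin/contrapT.
Qed.

(** As a type with its own order, a segment can be fed to the minimality clause of
    [is_succ_cardinal]. *)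
Definition seg d (T : orderType d) (x : T) : Type := {y : T | y < x}.
HB.instance Definition _ d (T : orderType d) (x : T) := SubChoice.on (seg x).
HB.instance Definition _ d (T : orderType d) (x : T) :=
  [SubChoice_isSubOrder of seg x by <: with d].

Lemma ordinal_seg d (T : orderType d) (x : T) : is_ordinal T -> is_ordinal (seg x).
Proof.
move=> Tord; apply: antisymmetric_well_order; first exact: le_anti.
move=> A [z0 Az0].
have [|y [z Az <-] ymin] :=
  ordinal_min (P := fun y => exists2 z : seg x, z \in A & val z = y)
    (x0 := val z0) Tord.
  by exists z0.
exists z; split=> // z' Az'; rewrite leNgt; apply/negP => z'z.
by apply: (ymin (val z')) => //; exists z'.
Qed.

Lemma card_seg d (T : orderType d) (x : T) : [set: seg x] #= [set y | y < x].
Proof.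
rewrite card_eq_le; apply/andP; split.
  by apply: (card_le_inj (f := val)) => [[]//|y z _ _ /val_inj].
apply: (card_le_rel (R := fun y z => y = val z)) => [y yx|y y' z _ _ -> ->//].
by exists (Sub y yx); rewrite ?SubK.
Qed.

(** If [x] is least such that its segment does not embed in [T], this segment is a cardinal above
    [T], so [S] embeds in it, although [S] is an initial ordinal. *)
Lemma succ_cardinal_seg d d' (T : orderType d) (S : orderType d') (a : S) :
  is_succ_cardinal T S -> [set y | y < a] #<= [set: T].
Proof.
move=> [[Sord Sseg] TS Smin]; apply: contrapT => nale.
have [x /card_ltNge Tx xmin] :=
  ordinal_min (P := fun x => ~ ([set y | y < x] #<= [set: T])) Sord nale.
have := card_seg x; rewrite card_eq_le => /andP[le_seg seg_le].
have Tseg : [set: T] #< [set: seg x].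
  by apply: card_ltNge => xT; case: Tx => _; apply; exact: card_le_trans seg_le xT.
have [_] := Sseg x; apply; apply: card_le_trans le_seg.
apply: (Smin d' (seg x)) => //; split; first exact: ordinal_seg.
move=> z; apply: card_le_lt_trans Tseg.
apply: (@card_le_trans _ _ _ [set y | y < val z]).
  by apply: (card_le_inj (f := val)) => [//|y y' _ _ /val_inj].
by have /contrapT := xmin _ (valP z).
Qed.

(** * Ranks from countable cofinality, and enumeration of functions *)

(** The rank of [t] is the index, in a countable cofinal set, of a chosen member at or above [t].
    Finitely many members have a common bound, so the elements of rank at most [n] lie in a proper
    initial segment. *)
Lemma countable_cofinality_rank d (T : orderType d) : is_cardinal T ->
  cofinality_is T nat ->
  exists r : T -> nat, forall n, [set t | (r t <= n)%N] #< [set: T].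
Proof.
move=> [_ Tseg] [_ [A [Acof AN]] Cmin].
have [j [_ jinj]] : exists j : T -> nat, (forall x, A x -> setT (j x)) /\
    (forall x y, A x -> A y -> j x = j y -> x = y).
  by apply: (card_le_ex_inj 0%N); move: AN; rewrite card_eq_le => /andP[].
(* A greatest element would form a cofinal set by itself. *)
have nomax (x : T) : exists y, x < y.
  apply: contrapT => nx.
  have : cofinal [set x].
    move=> y; exists x => //.
    by rewrite leNgt; apply/negP => xy; apply: nx; exists y.
  by move/Cmin/infiniteP; apply; exact: finite_set1.
have [x0 _] : A !=set0.
  apply/set0P/eqP => A0; move: AN; rewrite A0 card_eq_le => /andP[_].
  by move=> /infiniteP; apply; exact: finite_set0.
have bnd n : exists M : T, forall a, A a -> (j a <= n)%N -> a <= M.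
  have step (M : T) m :
      exists M' : T, M <= M' /\ forall a, A a -> j a = m -> a <= M'.
    have [[b [Ab jb]]|nb] := pselect (exists b, A b /\ j b = m).
      exists (Order.max M b); split=> [|a Aa ja]; first by rewrite le_max lexx.
      by rewrite (jinj a b) ?ja // le_max lexx orbT.
    by exists M; split=> // a Aa ja; case: nb; exists a.
  elim: n => [|n [M MP]].
    by have [M [_ MP]] := step x0 0%N;
       exists M => a Aa; rewrite leqn0 => /eqP/MP; exact.
  have [M' [MM' M'P]] := step M n.+1; exists M' => a Aa.
  rewrite leq_eqVlt => /orP[/eqP/M'P|]; first exact.
  by rewrite ltnS => /MP-/(_ Aa) aM; exact: le_trans aM MM'.
have /choice[a aP] : forall t, exists a, A a /\ t <= a.
  by move=> t; have [a] := Acof t; exists a.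
exists (j \o a) => n; have [M MP] := bnd n; have [M' MM'] := nomax M.
apply: card_le_lt_trans (Tseg M'); apply: subset_card_le => t /= /MP.
have [Aat tat] := aP t => /(_ Aat) atM.
exact: le_lt_trans tat (le_lt_trans atM MM').
Qed.

(** As [U] has the size of the power set of [T], a function from [T] to [U] amounts to a subset of
    [T * T], hence to one of [T], hence to a point of [U]; [e] inverts this coding [J]. *)
Lemma function_enumeration T U : infinite_set [set: T] ->
  [set: T -> bool] #= [set: U] ->
  exists e : U -> T -> U, forall f, exists a, e a = f.
Proof.
move=> Tinf; rewrite card_eq_le => /andP[BU UB].
have [t0 _] := infinite_setN0 Tinf.
have [j [_ jinj]] : exists j : (T -> bool) -> U, (forall x, setT x -> setT (j x)) /\
    (forall x y, setT x -> setT y -> j x = j y -> x = y).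
  have /set0P : [set: U] != set0.
    apply/eqP => U0; move: BU; rewrite U0 card_le0 => /eqP/seteqP[+ _].
    by move/(_ (fun=> true) I).
  by case=> u0 _; exact: card_le_ex_inj u0 BU.
have [i [_ iinj]] := card_le_ex_inj (fun _ : T => true) UB.
have [s [_ sinj]] := card_le_ex_inj t0 (card_le_square Tinf).
pose J (f : T -> U) := j (fun t => `[< exists2 p, s p = t & i (f p.1) p.2 >]).
have Jinj f g : J f = J g -> f = g.
  move=> /jinj-/(_ I I) fg; apply/funext => t.
  apply: iinj => //; apply/funext => t'.
  have sE (f' : T -> U) :
      `[< exists2 p, s p = s (t, t') & i (f' p.1) p.2 >] = i (f' t) t'.
    apply/asboolP/idP => [[p sp]|]; last by exists (t, t').
    by rewrite (sinj p (t, t')).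
  by rewrite -!sE; exact: (congr1 (fun F : T -> bool => F (s (t, t'))) fg).
have /choice[e eP] : forall a, exists f, (exists f', J f' = a) -> J f = a.
  move=> a; have [[f fa]|nf] := pselect (exists f', J f' = a); first by exists f.
  by exists (fun=> a).
exists e => f; exists (J f); apply: Jinj; apply: eP; by exists f.
Qed.

(** * Levels and the avoiding choice *)

Definition rank_seg d (S : orderType d) (rk : S -> S -> nat) (a : S)
    (n : nat) : set S :=
  [set b | b < a /\ (rk b a <= n)%N].

(* Contains every S(b, l) with b in I and l <= n; it is larger than their union
   because [y] may have rank up to [n] instead of [l]. *)
Definition level d (S : orderType d) (rk : S -> S -> nat) (p : S -> nat -> S -> S)
    (I : set S) (n : nat) : set S :=
  [set z | exists b l y, [/\ I b, (l <= n)%N, rank_seg rk b n y & z = p b l y]].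

(** Well-founded recursion on [a]: the level to be avoided involves [p b] only for [b < a]. *)
Lemma avoiding_choice d (S : orderType d) (rk : S -> S -> nat) (B : S -> set S) :
  is_ordinal S ->
  exists p : S -> nat -> S -> S, forall a n x,
    ~ (B x `<=` level rk p (rank_seg rk a n) n) ->
    B x (p a n x) /\ ~ level rk p (rank_seg rk a n) n (p a n x).
Proof.
(* The avoided set is [level] with recursive calls in place of [p]; [a] is a dummy value for when
   nothing can be chosen. *)
move=> Sord; pose F a (rec : forall b, b < a -> nat -> S -> S) n x : S :=
  xget a [set z | B x z /\ ~ exists b (ba : b < a) l y,
    [/\ (rk b a <= n)%N, (l <= n)%N, rank_seg rk b n y & z = rec b ba l y]].
pose p := Fix (ordinal_wf Sord) (fun=> nat -> S -> S) F.
exists p => a n x /existsNP[z /not_implyP[Bz nz]].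
pose W := [set z | B x z /\ ~ level rk p (rank_seg rk a n) n z].
suff -> : p a n x = xget a W.
  by apply: (xgetI a (P := W)); split; [exact: Bz|exact: nz].
rewrite /p Fix_eq -/p => [|b f g fg]; last first.
  suff -> : f = g by [].
  by apply: functional_extensionality_dep => c; apply: functional_extensionality_dep.
rewrite /F /W; congr xget; apply/seteqP; split=> u [Bu nu]; split=> // -[b].
  by move=> [l [y [[ba rba] ? ? ?]]]; apply: nu; exists b, ba, l, y.
by move=> [ba [l [y [? ? ? ?]]]]; apply: nu; exists b, l, y.
Qed.

(** A member [p b l y] is determined by [b] in [I], the number [l] and the element [h y b], on which
    [r] is at most [n]; each of these ranges over a set smaller than [T]. *)
Lemma card_level_lt d d' (T : orderType d) (S : orderType d') (r : T -> nat)
    (h : S -> S -> T) (p : S -> nat -> S -> S) (I : set S) n :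
  [set: nat] #< [set: T] ->
  (forall n, [set t | (r t <= n)%N] #< [set: T]) ->
  (forall a x y, x < a -> y < a -> h x a = h y a -> x = y) ->
  I #< [set: T] -> level (fun x a => r (h x a)) p I n #< [set: T].
Proof.
move=> natT rT hinj IT.
apply: card_le_lt_trans (card_ltX natT IT (card_ltX natT natT (rT n))).
apply: (card_le_rel (R := fun z q => exists y,
    [/\ y < q.1, h y q.1 = q.2.2 & z = p q.1 q.2.1 y])).
  by move=> z [b [l [y [Ib ln [yb rn] ->]]]]; exists (b, (l, h y b)) => //; exists y.
move=> z z' [b [l t]] _ _ [y [/= yb ht ->]] [y' [/= y'b ht' ->]].
by rewrite (hinj _ _ _ yb y'b) // ht ht'.
Qed.

Lemma card_rank_seg_lt d d' (T : orderType d) (S : orderType d') (r : T -> nat)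
    (h : S -> S -> T) a n :
  (forall n, [set t | (r t <= n)%N] #< [set: T]) ->
  (forall a x y, x < a -> y < a -> h x a = h y a -> x = y) ->
  rank_seg (fun x a => r (h x a)) a n #< [set: T].
Proof.
move=> rT hinj; apply: card_le_lt_trans (rT n).
apply: (card_le_inj (f := h^~ a)) => [x [_ //]|x y [xa _] [ya _]].
exact: hinj.
Qed.

(* Above level [n], the level of [z] strictly decreases along [beta]. *)
Lemma level_path d (S : orderType d) (rk : S -> S -> nat)
    (p : S -> nat -> S -> S) (Q : set S) (beta : nat -> S) (n : nat) z :
  (forall a m x, Q x -> ~ level rk p (rank_seg rk a m) m (p a m x)) ->
  (forall k, beta k < beta k.+1) -> (forall k, (rk (beta k) (beta k.+1) <= n)%N) ->
  (forall k, exists l y, [/\ Q y, rank_seg rk (beta k) l y & z = p (beta k) l y]) ->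
  level rk p (range beta) n z.
Proof.
move=> pavoid binc brk zlev; apply: contrapT => nz.
suff noz m : forall k, ~ exists y,
    [/\ Q y, rank_seg rk (beta k) m y & z = p (beta k) m y].
  by have [l /(noz l)] := zlev 0%N.
elim/ltn_ind: m => m IHm k [y [Qy ym zE]].
have [l [x [Qx xl zE']]] := zlev k.+1.
have nl : (n < l)%N.
  rewrite ltnNge; apply/negP => ln; apply: nz; exists (beta k.+1), l, x.
  by split=> //; case: xl => ? xl; split=> //; exact: leq_trans xl ln.
(* If [m <= l], then [beta k] and [y] count for level [l] at [beta k.+1], since [beta k] has rank at
   most [n < l] there. So the choice of [z] at [beta k.+1] had to avoid [p (beta k) m y], which is
   [z]. *)
have [ml|lm] := leqP m l; last by apply: (IHm _ lm k.+1); exists x.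
apply: (pavoid (beta k.+1) l x Qx); rewrite -zE'; exists (beta k), m, y; split=> //.
  by split=> //; exact: leq_trans (brk k) (ltnW nl).
by case: ym => ? ym; split=> //; exact: leq_trans ym ml.
Qed.

(** * Paths of bounded rank *)

Lemma ipath_ipath_fin d (K : orderType d) : ipath K nat -> ipath_fin K nat.
Proof.
move=> Kpath c; have [beta [incr [gamma cg]]] := Kpath c; exists beta, incr.
by apply: sub_finite_set (finite_set1 gamma) => _ [k _ <-]; exact: cg.
Qed.

(** A pair is coloured by the rank of its increasing listing; the maximum of the finitely many
    colours on the path is the bound [n]. *)
Lemma ipath_fin_bounded d (K : orderType d) (rk : K -> K -> nat) :
  ipath_fin K nat -> exists (beta : nat -> K) n,
    (forall k, beta k < beta k.+1) /\ (forall k, (rk (beta k) (beta k.+1) <= n)%N).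
Proof.
move=> /(_ (fun q => xget 0%N [set n | exists x y,
  [/\ x < y, sval q = [set x; y] & n = rk x y]]))[beta [incr]] cfin.
(* The increasing listing of a pair is unique, so [xget] recovers the rank. *)
have cE x y (xy : x < y) : xget 0%N [set n | exists x' y',
    [/\ x' < y', sval (two_subset xy) = [set x'; y'] & n = rk x' y']] = rk x y.
  case: xgetP => [m _ [x' [y' [x'y' /= e ->]]]|/(_ (rk x y))[]]; last by exists x, y.
  have : [set x'; y'] x by rewrite -e; left.
  have : [set x'; y'] y by rewrite -e; right.
  move=> [] yE [] xE; move: xy; rewrite xE yE ?ltxx // => y'x'.
  by move: (lt_trans x'y' y'x'); rewrite ltxx.
have /finite_seqP[s sE] := cfin.
exists beta, (\max_(i <- s) i); split=> // k; rewrite -(cE _ _ (incr k)).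
apply: (leq_bigmax_seq (F := id)) => //.
suff : [set` s] (xget 0%N [set n | exists x' y', [/\ x' < y',
    sval (two_subset (incr k)) = [set x'; y'] & n = rk x' y']]) by [].
by rewrite -sE; exists k.
Qed.

(** * The colouring and its two negative properties *)

Theorem theorem2p3
  (dmu dmup dkappa : Order.disp_t)
  (mu : orderType dmu) (mup : orderType dmup) (kappa : orderType dkappa)
  (mu_singular : is_singular mu)
  (mu_gt_omega : [set: nat] #< [set: mu])
  (cf_mu : cofinality_is mu nat)
  (mup_succ : is_succ_cardinal mu mup)
  (pow_mu : [set: mu -> bool] #= [set: mup])
  (kappa_card : is_cardinal kappa)
  (kappa_ipath : ipath kappa nat \/ ipath_fin kappa nat) :
  exists c : mup * mup -> 'I_2,
    (~ exists A B : set mup,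
         [/\ otp_is A mup, otp_is B mu & c @` (A `*` B) = [set ord0]]) /\
    (~ exists A B : set mup,
         c @` (A `*` B) = [set ord_max] /\
         ((otp_is A kappa /\ otp_is B mu) \/
          (otp_is A 'I_1 /\ otp_is B mup))).
Proof.
have [mu_card mu_inf _] := mu_singular.
have [[mup_ord _] [_ mup_nle_mu] _] := mup_succ.
have [t0 _] := infinite_setN0 mu_inf.
have [e e_surj] := function_enumeration mu_inf pow_mu.
have [r r_lt] := countable_cofinality_rank mu_card cf_mu.
have /choice[h hP] a := card_le_ex_inj t0 (succ_cardinal_seg a mup_succ).
have h_inj a x y : x < a -> y < a -> h a x = h a y -> x = y.
  by case: (hP a) => _; exact.
pose rk x a := r (h a x).
have [p pP] := avoiding_choice rk (fun x => range (e x)) mup_ord.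
(* For injective [e x] the range has the size of [mu], while the level is smaller and cannot include
   it. *)
have {}pP a n x : injective (e x) -> range (e x) (p a n x) /\
    ~ level rk p (rank_seg rk a n) n (p a n x).
  move=> ex_inj; apply: pP => /subset_card_le range_le.
  have := card_rank_seg_lt (h := fun x a => h a x) a n r_lt h_inj.
  move/(card_level_lt (h := fun x a => h a x) p n mu_gt_omega r_lt h_inj).
  case=> _; apply; apply: card_le_trans range_le.
  by apply: (card_le_inj (f := e x)) => [t _|t t' _ _ /ex_inj//]; exists t.
pose S a z := exists l y, [/\ injective (e y), rank_seg rk a l y & z = p a l y].
have otp_card d (X : orderType d) (A : set mup) : otp_is A X -> [set: X] #<= A.
  move=> [f [f_mono <-]]; apply: (card_le_inj (f := f)) => [x _|x y _ _ fxy].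
    by exists x.
  by apply/eqP; rewrite eq_le -!f_mono fxy lexx.
exists (fun q => if `[< S q.1 q.2 >] then ord_max else ord0); split.
- move=> [A [B [/otp_card mupA [g [g_mono gB]] cAB]]].
  have g_inj : injective g.
    by move=> t t' gtt'; apply/eqP; rewrite eq_le -!g_mono gtt' lexx.
  have [x ex] := e_surj g.
  (* At most [mu] many elements lie at or below [x], too few to exhaust [A]. *)
  have [a Aa xa] : exists2 a, A a & x < a.
    apply: contrapT => nA; apply: mup_nle_mu; apply: card_le_trans mupA _.
    apply: card_le_trans (subset_card_le (_ : A `<=` [set y | y < x] `|` [set x])) _.
      move=> a Aa; have [ax|xa|->] := ltgtP a x; [by left| |by right].
      by case: nA; exists a.
    have /infiniteP/(card_le_ex_inj t0)[u [_ u_inj]] := mu_inf.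
    apply: card_le_trans (card_le_square mu_inf).
    apply: (@card_leU _ _ _ _ _ (u 0%N) (u 1%N)) => //.
    + by move=> /u_inj => /(_ I I).
    + exact: succ_cardinal_seg mup_succ.
    + by apply: (card_le_inj (f := fun=> t0)) => // ? ? -> ->.
  have ex_inj : injective (e x) by rewrite ex.
  (* [rk x a] is the least level at [a] that admits [x]. *)
  have [Bp _] := pP a (rk x a) x ex_inj.
  have : [set ord0] (ord_max : 'I_2); last by [].
  rewrite -cAB; exists (a, p a (rk x a) x).
    by split=> //=; rewrite -gB -ex.
  by rewrite asboolT //=; exists (rk x a), x.
- move=> [A [B [cAB AB]]].
  have SAB a z : A a -> B z -> S a z.
    move=> Aa Bz; apply: contrapT => nS.
    have : [set ord_max] (ord0 : 'I_2); last by [].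
    by rewrite -cAB; exists (a, z) => //=; rewrite asboolF.
  case: AB => [[[f [f_mono fA]] /otp_card muB]|[[f [_ fA]] /otp_card mupB]].
  + have kappa_fin : ipath_fin kappa nat by case: kappa_ipath => // /ipath_ipath_fin.
    have [beta [n [beta_incr beta_rk]]] :=
      ipath_fin_bounded (fun x y => rk (f x) (f y)) kappa_fin.
    have f_lt := leW_mono f_mono.
    (* The path is countable, so the level over it is smaller than [mu]; by [level_path] it would
       contain all of [B]. *)
    have range_lt : range (f \o beta) #< [set: mu].
      by apply: card_le_lt_trans mu_gt_omega; exact: card_image_le.
    have [_] := card_level_lt (h := fun x a => h a x) p n mu_gt_omega r_lt
      h_inj range_lt.
    apply; apply: card_le_trans muB _; apply: subset_card_le => z Bz.
    apply: (@level_path _ _ _ _ (fun x => injective (e x))) => [a m x ex_inj|k|k|k] //.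
    * by have [] := pP a m x ex_inj.
    * by rewrite /= f_lt.
    * exact: beta_rk.
    * by apply: (SAB (f (beta k)) z) => //; rewrite -fA; exists (beta k).
  (* For a single [a], a member of [S a] is coded by its level and the image under [h a] of its
     index, so there are at most [mu] of them. *)
  + apply: mup_nle_mu; apply: card_le_trans mupB _.
    have [natmu _] := mu_gt_omega.
    apply: card_le_trans (card_le_square mu_inf).
    apply: card_le_trans (card_leX natmu (card_lexx _)).
    apply: (card_le_rel (R := fun z q => exists y,
      [/\ y < f ord0, h (f ord0) y = q.2 & z = p (f ord0) q.1 y])).
      move=> z Bz; have [|l [y [_ [yf _] ->]]] := SAB (f ord0) z _ Bz.
        by rewrite -fA; exists ord0.
      by exists (l, h (f ord0) y) => //; exists y.
    move=> z z' [l t] _ _ [y [/= ya ht ->]] [y' [/= y'a ht' ->]].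
    by rewrite (h_inj _ _ _ ya y'a) // ht ht'.
Qed.
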